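(* There is an absolute constant $c>0$ such that for every prime $p$ there is a function $f:\mathbb{Z}/p\mathbb{Z}\to\mathbb{R}$ with $\mathbb{E} f=0$, $\Vert f\Vert_2\leq 1$, and \[ |f\ast f^{\circ}(x)| \;\geq\; \frac{c}{\log p}\qquad\text{for all } x\in\mathbb{Z}/p\mathbb{Z}. \]
   Context: For functions on $\mathbb{Z}/p\mathbb{Z}$: $\mathbb{E} f:=\frac1p\sum_{x} f(x)$; $\Vert f\Vert_2:=\left(\frac1p\sum_x |f(x)|^2\right)^{1/2}$; $f\ast g(x):=\frac1p\sum_{y\in\mathbb{Z}/p\mathbb{Z}} f(y)g(x-y)$; and $f^{\circ}(x):=f(-x)$. *)

(* Defs.v *)
From mathcomp Require Import all_boot all_order all_algebra.
From mathcomp Require Import reals exp.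

Set Implicit Arguments.
Unset Strict Implicit.
Unset Printing Implicit Defensive.

Import Order.TTheory GRing.Theory Num.Theory.
Local Open Scope ring_scope.

(* In mathcomp, 'Z_p has max(p, 2) elements, so these normalisations are the
   intended ones for 1 < p, in particular for p prime. *)

Definition expect (R : realType) (p : nat) (f : 'Z_p -> R) : R :=
  p%:R^-1 * \sum_(x : 'Z_p) f x.

Definition norm2 (R : realType) (p : nat) (f : 'Z_p -> R) : R :=
  Num.sqrt (p%:R^-1 * \sum_(x : 'Z_p) `|f x| ^+ 2).

Definition conv (R : realType) (p : nat) (f g : 'Z_p -> R) : 'Z_p -> R :=
  fun x => p%:R^-1 * \sum_(y : 'Z_p) f y * g (x - y).

Definition refl (R : realType) (p : nat) (f : 'Z_p -> R) : 'Z_p -> R :=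
  fun x => f (- x).

(* Main.v *)
Require Import Defs.
From mathcomp Require Import all_boot all_order all_algebra.
From mathcomp Require Import reals exp.
From mathcomp Require Import trigo derive topology normedtype.
From mathcomp Require Import ring lra zify.

Set Implicit Arguments.
Unset Strict Implicit.

Import Order.TTheory GRing.Theory Num.Theory.
Import numFieldNormedType.Exports.
Local Open Scope ring_scope.

(** Any [w >= 0] on the frequencies with [w 0 = 0] and [w (p - k) = w k] is the
    Fourier transform of an autocorrelation [f * f°] (take square roots on the
    Fourier side), with [E f = 0] and [norm2 f ^ 2] the total mass of [w].  For
    odd [p] take [w k] proportional to
    [(1 + sin ((2m+1) pi k / p)) / (p sin (pi k / p))], which is nonnegative.
    Its transform is [L + S], where [S x = 1_{|x| <= m} - (2m+1)/p] comes from
    the Dirichlet kernel and [L], from the cosecant, decreases on [0, p/2], with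
    consecutive differences [2/p cot (pi (2x+1) / (2p))].  Since [L] has mean
    zero, the jump of [S] can be placed (choice of [m]) so that [L + S] stays
    above 1/8 before it and below -1/8 after it.  The mass is [O(log p)]
    because [cot t <= 1/t], and normalising it costs the factor [log p]. *)

(** * Angles pi n / p and orthogonality of cosines *)

Definition ang {R : realType} (p n : nat) : R := pi * n%:R / p%:R.

Lemma ang0 (R : realType) p : ang p 0 = 0 :> R.
Proof. by rewrite /ang mulr0 mul0r. Qed.

Lemma angD (R : realType) p m n : ang p (m + n) = ang p m + ang p n :> R.
Proof. by rewrite /ang natrD; ring. Qed.

Lemma ang_period (R : realType) p n : (0 < p)%N -> ang p (n * p) = pi *+ n :> R.
Proof.
move=> p0; rewrite /ang natrM mulrA mulfK ?mulr_natr//.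
by rewrite pnatr_eq0 -lt0n.
Qed.

Lemma sin_ang_gt0 (R : realType) p k : (0 < k < p)%N -> 0 < sin (ang p k : R).
Proof.
move=> /andP[k0 kp]; have p0 : 0 < p%:R :> R by rewrite ltr0n; lia.
apply: sin_gt0_pi; rewrite /ang divr_gt0 ?mulr_gt0 ?pi_gt0//= ?ltr0n//.
by rewrite ltr_pdivrMr// ltr_pM2l ?pi_gt0// ltr_nat.
Qed.

Lemma sin_ang_ge0 (R : realType) p k : (k < p)%N -> 0 <= sin (ang p k : R).
Proof.
case: k => [|k] kp; first by rewrite ang0 sin0.
by rewrite ltW// sin_ang_gt0.
Qed.

Lemma sin_ang_neq0 (R : realType) p n : (0 < p)%N -> ~~ (p %| n)%N ->
  sin (ang p n) != 0 :> R.
Proof.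
move=> p0; rewrite /dvdn -lt0n => np.
rewrite {1}(divn_eq n p) addnC angD ang_period// (alternatingn (@sinDpi R)).
by rewrite mulf_neq0 ?signr_eq0// lt0r_neq0// sin_ang_gt0// np ltn_mod.
Qed.

Lemma cosD_ang_period (R : realType) p n (a : R) : (0 < p)%N ->
  cos (a + ang p (2 * (n * p))) = cos a.
Proof.
by move=> p0; rewrite mulnA ang_period// mulrnA (periodicn (@cosD2pi R)).
Qed.

(** If p divides n, every term is [cos phi]. Otherwise multiplying by the nonzero [sin (ang p n)]
    makes the sum telescope, and its two ends differ by the angle 2 pi n. *)
Lemma sum_cos_ang (R : realType) p n (phi : R) : (0 < p)%N ->
  \sum_(y < p) cos (ang p (2 * (n * y)) + phi) = (p %| n)%N%:R * p%:R * cos phi.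
Proof.
move=> p0; case: (boolP (p %| n)%N) => [/dvdnP[q ->]|np].
  under eq_bigr => y _.
    rewrite (_ : q * p * y = q * y * p)%N; last lia.
    rewrite addrC cosD_ang_period//.
  over.
  by rewrite sumr_const card_ord mul1r mulr_natl.
rewrite !mul0r; apply: (mulfI (sin_ang_neq0 R p0 np)); rewrite mulr0.
pose g y : R := sin (ang p (2 * (n * y)) + phi - ang p n).
have gE y : sin (ang p n) * cos (ang p (2 * (n * y)) + phi)
  = 2^-1 * (g y.+1 - g y).
  rewrite /g (_ : 2 * (n * y.+1) = 2 * (n * y) + n + n)%N; last lia.
  have -> : ang p (2 * (n * y) + n + n) + phi - ang p n =
    ang p (2 * (n * y)) + phi + ang p n :> R by rewrite !angD; ring.
  by rewrite [sin (_ + ang p n)]sinD sinB; field.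
rewrite mulr_sumr; under eq_bigr do rewrite gE.
rewrite -mulr_sumr -(big_mkord xpredT (fun y => g y.+1 - g y)) telescope_sumr//.
rewrite /g muln0 muln0 ang0 mulnA (@ang_period R p (2 * n)) // mulrnA.
rewrite -addrA [pi *+ 2 *+ n + _]addrC (periodicn (@sinD2pi R)).
by rewrite add0r subrr mulr0.
Qed.

Lemma cosMcos (R : realType) (a b : R) :
  cos a * cos b = 2^-1 * (cos (a + b) + cos (a - b)).
Proof. by rewrite cosD cosB; field. Qed.

(** Product-to-sum reduces this to [sum_cos_ang] at the frequencies k + l and k - l. The latter is
    written [k + (p - l)] to stay in [nat], at the cost of a phase 2 pi y. *)
Lemma sum_cosMcos_ang (R : realType) p k l (phi : R) : (0 < p)%N -> (l <= p)%N ->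
  \sum_(y < p) cos (ang p (2 * (k * y))) * cos (ang p (2 * (l * y)) + phi) =
  2^-1 * ((p %| k + l)%N%:R + (p %| k + (p - l))%N%:R) * p%:R * cos phi.
Proof.
move=> p0 lp; under eq_bigr => y _.
  rewrite cosMcos.
  rewrite addrA -angD (_ : 2 * (k * y) + 2 * (l * y) = 2 * ((k + l) * y))%N;
    last lia.
  rewrite -(@cosD_ang_period R p y (ang p _ - _)) //.
  have -> : ang p (2 * (k * y)) - (ang p (2 * (l * y)) + phi) +
    ang p (2 * (y * p)) = ang p (2 * ((k + (p - l)) * y)) + - phi :> R.
    apply: (addIr (ang p (2 * (l * y)) + phi)).
    rewrite addrAC subrK -angD addrACA addNr addr0 -angD.
    by congr (ang p _); nia.
over.
rewrite -mulr_sumr big_split /= !sum_cos_ang// cosN; ring.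
Qed.

(** * The real Fourier transform and autocorrelations with given spectrum *)

(** For weights symmetric under k -> p - k the sine parts cancel, so this is the full Fourier
    transform and no complex numbers are needed. *)
Definition cos_transform {R : realType} (p : nat) (w : nat -> R) (x : nat) : R :=
  \sum_(k < p) w k * cos (ang p (2 * (k * x))).

Lemma cos_transform_sym (R : realType) p (w : nat -> R) x :
  (0 < p)%N -> (x <= p)%N -> cos_transform p w (p - x) = cos_transform p w x.
Proof.
move=> p0 xp; apply: eq_bigr => k _; congr (_ * _).
rewrite -cosN -(@cosD_ang_period R p k) //; congr cos.
apply: (addrI (ang p (2 * (k * (p - x))))); rewrite addrA subrr add0r -angD.
by congr (ang p _); nia.
Qed.

Lemma sum_cos_transform (R : realType) p (w : nat -> R) : (0 < p)%N ->
  w 0%N = 0 -> \sum_(x < p) cos_transform p w x = 0.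
Proof.
move=> p0 w0; rewrite exchange_big big1//= => k _; rewrite -mulr_sumr.
under eq_bigr do rewrite -[ang _ _]addr0.
rewrite sum_cos_ang//; case: k => [[|k] kp]/=; first by rewrite w0 mul0r.
by rewrite gtnNdvd// !mul0r mulr0.
Qed.

Lemma sum_ord_indic (R : realType) p (a : nat -> R) (P : pred nat) i : (i < p)%N ->
  (forall k, (k < p)%N -> P k = (k == i)) -> \sum_(k < p) a k * (P k)%:R = a i.
Proof.
move=> ip Pi; rewrite (bigD1 (Ordinal ip))//= Pi// eqxx mulr1 big1 ?addr0// => k.
rewrite -val_eqE /= => ki; rewrite Pi// (negbTE ki) mulr0//.
Qed.

(** The convolution theorem: the inner sum is the transform of [a] at y - x, written without
    reduction mod p. Orthogonality leaves k = l and k = -l mod p, each contributing [a l] by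
    symmetry, which cancels the factor 1/2. *)
Lemma sum_cos_transformM (R : realType) p (a : nat -> R) x : (0 < p)%N ->
  a 0%N = 0 -> (forall k, (0 < k < p)%N -> a (p - k)%N = a k) ->
  \sum_(y < p) cos_transform p a y *
    (\sum_(l < p) a l * cos (ang p (2 * (l * y)) + - ang p (2 * (l * x)))) =
  p%:R * cos_transform p (fun k => a k ^+ 2) x.
Proof.
move=> p0 a0 asym.
have distr (u v d1 d2 z t : R) : u * v * (2^-1 * (d1 + d2) * z * t) =
  (u * d1 + u * d2) * (2^-1 * z * v * t) by ring.
under eq_bigr => y _.
  rewrite mulr_sumr.
  under eq_bigr do rewrite mulr_suml.
over.
rewrite exchange_big /= mulr_sumr; apply: eq_bigr => l _.
rewrite exchange_big /=; under eq_bigr => k _.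
  under eq_bigr do rewrite mulrACA.
  rewrite -mulr_sumr (sum_cosMcos_ang _ _ p0 (ltnW (ltn_ord l))) cosN.
  rewrite (distr (a k)).
over.
rewrite -mulr_suml big_split /=.
have lp := ltn_ord l.
rewrite (@sum_ord_indic R p a (fun k => p %| k + (p - l))%N l)//; last first.
  move=> k kp; apply/idP/eqP => [/dvdnP[[|[|q]]]|->]; last by rewrite subnKC// ltnW.
  1-3: by rewrite ?mulSn; lia.
have -> : \sum_(k < p) a k * (p %| k + l)%N%:R = a l.
  have [l0|l0] := posnP l.
    rewrite l0; under eq_bigr => k _ do rewrite addn0.
    rewrite (@sum_ord_indic R p a (dvdn p) 0%N)// => k kp.
    apply/idP/eqP => [/dvdnP[[|[|q]]]|->]//; rewrite ?mulSn; lia.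
  rewrite (@sum_ord_indic R p a (fun k => p %| k + l)%N (p - l)%N); last first.
  - move=> k kp; apply/idP/eqP => [/dvdnP[[|[|q]]]|->]; last by rewrite subnK// ltnW.
  1-3: by rewrite ?mulSn; lia.
  - lia.
  by rewrite asym// l0 /=.
by field.
Qed.

Lemma exists_autocorrelation (R : realType) p (w : nat -> R) : (1 < p)%N ->
  (forall k, (k < p)%N -> 0 <= w k) -> w 0%N = 0 ->
  (forall k, (0 < k < p)%N -> w (p - k)%N = w k) ->
  exists f : 'Z_p -> R,
    [/\ expect f = 0, norm2 f = Num.sqrt (cos_transform p w 0) &
        forall x, conv f (refl f) x = cos_transform p w x].
Proof.
(* With p of the form [n.+2], the type ['Z_p] is convertible to ['I_p], so both kinds of sums
   agree. *)
case: p => [|[|n]]// _ w_ge0 w0 wsym; pose p := n.+2.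
have pR0 : n.+2%:R != 0 :> R by rewrite pnatr_eq0.
pose a k := Num.sqrt (w k).
have a0 : a 0%N = 0 by rewrite /a w0 sqrtr0.
have asym k : (0 < k < p)%N -> a (p - k)%N = a k by move=> kp; rewrite /a wsym.
exists (fun x : 'Z_p => cos_transform p a x).
set f := fun x : 'Z_p => _.
have fB (y x : 'Z_p) : f (y - x) =
    \sum_(k < p) a k * cos (ang p (2 * (k * y)) + - ang p (2 * (k * x))).
  apply: eq_bigr => k _; congr (_ * _).
  (* The representative of y - x may be off by a multiple of p; this changes the phase by a multiple
     of 2 pi. *)
  have [q qE] : exists q, ((y - x)%R + x = y + q * p)%N.
    exists ((val (y - x)%R + val x) %/ p)%N.
    rewrite {1}(divn_eq (val (y - x)%R + val x) p) addnC; congr addn.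
    by have /(congr1 val) /= := subrK x y.
  rewrite -(@cosD_ang_period R p (k * q)%N (_ - _))//; congr cos.
  apply: (addIr (ang p (2 * (k * x)))); rewrite addrAC subrK -!angD.
  by congr (ang p _); nia.
have fconv x : conv f (refl f) x = cos_transform p w x.
  transitivity (cos_transform p (fun k => a k ^+ 2) x); last first.
    by apply: eq_bigr => k _; rewrite sqr_sqrtr// w_ge0.
  apply: (mulfI pR0); rewrite /conv /refl mulVKf//.
  rewrite -sum_cos_transformM//.
  by apply: eq_bigr => y _; rewrite opprB fB.
split=> //.
  rewrite /expect [X in _ * X](_ : _ = 0) ?mulr0//.
  exact: (@sum_cos_transform R p).
(* The square of [norm2 f] is the autocorrelation at 0. *)
rewrite /norm2 -[0%N]/(val (0 : 'Z_p)) -fconv /conv /refl; congr (Num.sqrt (_ * _)).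
by apply: eq_bigr => y _; rewrite opprB subr0 real_normK ?num_real.
Qed.

Lemma cos_transformD (R : realType) p (v w : nat -> R) x :
  cos_transform p (fun k => v k + w k) x =
  cos_transform p v x + cos_transform p w x.
Proof.
by rewrite /cos_transform -big_split; apply: eq_bigr => k _; rewrite mulrDl.
Qed.

Lemma cos_transformZ (R : realType) p (a : R) (w : nat -> R) x :
  cos_transform p (fun k => a * w k) x = a * cos_transform p w x.
Proof.
by rewrite /cos_transform mulr_sumr; apply: eq_bigr => k _; rewrite mulrA.
Qed.

(** * Transform of the Dirichlet kernel *)

(* The Dirichlet kernel divided by [p]; at [k = 0] the division by zero makes
   the value 0, which is the mean-zero normalisation we want. *)
Definition dirichlet {R : realType} (p m k : nat) : R :=
  sin (ang p ((2 * m).+1 * k)) / (p%:R * sin (ang p k)).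

Lemma cos_transform_dirichlet0 (R : realType) p x : (x < p)%N ->
  cos_transform p (dirichlet p 0) x = (x == 0%N)%:R - p%:R^-1 :> R.
Proof.
case: p => // n xp; set p := n.+1; have pR : p%:R != 0 :> R by rewrite pnatr_eq0.
have := sum_cos_ang x (0 : R) (isT : 0 < p)%N.
rewrite big_ord_recl muln0 muln0 ang0 addr0 cos0 mulr1 => H.
have -> : (x == 0)%N = (p %| x)%N.
  by case: x xp {H} => [|x] xp; rewrite ?dvdn0// gtnNdvd.
transitivity (p%:R^-1 *
    \sum_(i < n) cos (ang p (2 * (x * fintype.lift ord0 i)) + 0) : R).
  rewrite /cos_transform big_ord_recl /dirichlet /= ang0 sin0 mulr0 invr0 mulr0.
  rewrite mul0r add0r mulr_sumr; apply: eq_bigr => i _.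
  rewrite addr0 [(x * _)%N]mulnC muln0 mul1n invfM mulrCA mulfV ?mulr1//.
  by apply: lt0r_neq0; apply: sin_ang_gt0; rewrite /bump /= add1n ltnS ltn_ord.
rewrite (_ : \sum_(i < n) _ = (p %| x)%:R * p%:R - 1); last by rewrite -H; ring.
by field.
Qed.

(** With t = pi k / p, the numerator grows by sin((2m+3)t) - sin((2m+1)t) = 2 cos(2(m+1)t) sin t,
    whose last factor cancels the denominator. Orthogonality evaluates what is left; the absent term
    k = 0 accounts for -2/p. *)
Lemma cos_transform_dirichletS (R : realType) p m x : (m.+1 + x < p)%N ->
  cos_transform p (dirichlet p m.+1) x =
  cos_transform p (dirichlet p m) x + (x == m.+1)%:R - 2 / p%:R :> R.
Proof.
case: p => // n mxp; set p := n.+1; have pR : p%:R != 0 :> R by rewrite pnatr_eq0.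
have xp : (x <= p)%N by rewrite /p; lia.
have := sum_cosMcos_ang m.+1 (0 : R) (isT : 0 < p)%N xp.
rewrite big_ord_recl !muln0 ang0 addr0 cos0 !mulr1.
rewrite (gtnNdvd _ mxp)// add0r.
have -> : (p %| m.+1 + (p - x))%N = (x == m.+1).
  apply/idP/eqP => [/dvdnP[[|[|q]]]|->]; rewrite ?subnKC ?mulSn ?mul0n ?addn0//; rewrite /p; try lia.
move=> H.
suff : cos_transform p (dirichlet p m.+1) x - cos_transform p (dirichlet p m) x =
    2 / p%:R * \sum_(i < n) cos (ang p (2 * (m.+1 * fintype.lift ord0 i))) *
      cos (ang p (2 * (x * fintype.lift ord0 i)) + 0) :> R.
  set s := \sum_(i < n) _ in H *.
  rewrite (_ : s = 2^-1 * (x == m.+1)%:R * p%:R - 1); last by rewrite -H; ring.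
  by move=> /(canRL (subrK _)) ->; field.
rewrite /cos_transform -sumrB big_ord_recl {1 2}/dirichlet /= ang0 sin0 mulr0 invr0.
rewrite !mulr0 !mul0r subrr add0r mulr_sumr; apply: eq_bigr => i _.
set k := bump 0 i; rewrite -mulrBl addr0 [(x * _)%N]mulnC mulrA; congr (_ * _).
rewrite /dirichlet -mulrBl.
have s0 : sin (ang p k : R) != 0.
  by apply: lt0r_neq0; apply: sin_ang_gt0; rewrite /k /bump /= add1n ltnS ltn_ord.
rewrite (_ : (2 * m.+1).+1 * k = 2 * (m.+1 * k) + k)%N; last by lia.
rewrite [sin (ang p (_ + _))](_ : _ = sin (ang p (2 * (m.+1 * k)) + ang p k)); last by rewrite angD.
rewrite [sin (ang p ((2 * m).+1 * k))](_ : _ = sin (ang p (2 * (m.+1 * k)) - ang p k)); last first.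
  congr sin; apply: (addIr (ang p k)); rewrite subrK -angD; congr ang; lia.
by rewrite sinD sinB; field; rewrite pR s0.
Qed.

(** The condition [m + x < p] keeps x out of p - m, ..., p - 1, the residues of the negative half of
    the interval. *)
Lemma cos_transform_dirichlet (R : realType) p m x : (m + x < p)%N ->
  cos_transform p (dirichlet p m) x = (x <= m)%N%:R - (2 * m).+1%:R / p%:R :> R.
Proof.
elim: m => [|m IH] mxp.
  by rewrite cos_transform_dirichlet0// leqn0 muln0 mul1r.
rewrite cos_transform_dirichletS// IH; last lia.
have -> : (x <= m.+1)%N%:R = (x <= m)%N%:R + (x == m.+1)%:R :> R.
  by rewrite -natrD; congr _%:R; lia.
rewrite (_ : (2 * m.+1).+1 = (2 * m).+1 + 2)%N ?natrD; [ring|lia].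
Qed.

(** * The cosecant weight: monotonicity and size of its transform *)

(** As for [dirichlet], inverting 0 gives the value 0 at k = 0, hence a transform of mean zero. *)
Definition cosec {R : realType} (p k : nat) : R := (p%:R * sin (ang p k))^-1.

(** The sum telescopes after multiplication by the sine of the half angle. Since 2x + 1 is odd, the
    two end terms add up instead of cancelling. *)
Lemma sum_sin_ang (R : realType) p x : (0 < p)%N ->
  sin (ang p (2 * x).+1 / 2) * \sum_(k < p) sin (ang p ((2 * x).+1 * k)) =
  cos (ang p (2 * x).+1 / 2) :> R.
Proof.
move=> p0; set t := _ / 2.
have tE k : ang p ((2 * x).+1 * k) = 2 * k%:R * t :> R.
  by rewrite /t /ang natrM; field; rewrite pnatr_eq0 -lt0n.
pose g k : R := - cos (2 * k%:R * t - t).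
have gE k : sin t * sin (ang p ((2 * x).+1 * k)) = 2^-1 * (g k.+1 - g k).
  rewrite tE /g (_ : 2 * k.+1%:R * t - t = 2 * k%:R * t + t);
    last by rewrite -natr1; ring.
  by rewrite cosD cosB; field.
rewrite mulr_sumr; under eq_bigr do rewrite gE.
rewrite -mulr_sumr -(big_mkord xpredT (fun y => g y.+1 - g y)) telescope_sumr//.
rewrite /g mulr0 mul0r add0r cosN -tE ang_period//.
have -> : pi *+ (2 * x).+1 - t = - t + pi + pi *+ 2 *+ x :> R.
  by rewrite (mulrS pi (2 * x)) (mulrnA pi 2 x) [LHS]addrC addrA.
by rewrite (periodicn (@cosD2pi R)) cosDpi cosN; field.
Qed.

(** The difference of the two cosines is 2 sin((2x+1) pi k / p) sin(pi k / p); the second factor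
    cancels the cosecant and leaves the sum of [sum_sin_ang]. *)
Lemma cos_transform_cosec_diff (R : realType) p x : ((2 * x).+1 < p)%N ->
  cos_transform p (cosec p) x - cos_transform p (cosec p) x.+1 =
  2 / p%:R * (cos (ang p (2 * x).+1 / 2) / sin (ang p (2 * x).+1 / 2)) :> R.
Proof.
move=> xp; have p0 : (0 < p)%N by lia.
have pR : p%:R != 0 :> R by rewrite pnatr_eq0 -lt0n.
rewrite -(sum_sin_ang _ _ p0).
have [a0 api] : 0 < ang p (2 * x).+1 :> R /\ ang p (2 * x).+1 < pi :> R.
  rewrite /ang divr_gt0 ?mulr_gt0 ?pi_gt0 ?ltr0n//; split=> //.
  by rewrite ltr_pdivrMr ?ltr0n// ltr_pM2l ?pi_gt0// ltr_nat.
have t0 : sin (ang p (2 * x).+1 / 2) != 0 :> R.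
  by apply/lt0r_neq0/sin_gt0_pi; apply/andP; split; lra.
rewrite [sin _ * _]mulrC mulfK// mulr_sumr -sumrB; apply: eq_bigr => k _.
rewrite -mulrBr.
have [k0|k0] := posnP k; first by rewrite k0 !mul0n !muln0 !ang0 subrr sin0 !mulr0.
have s0 : sin (ang p k : R) != 0.
  by apply/lt0r_neq0/sin_ang_gt0; rewrite k0 ltn_ord.
rewrite [cos (ang p (2 * (k * x)))](_ : _ = cos (ang p ((2 * x).+1 * k) - ang p k)); last first.
  congr cos; apply: (addIr (ang p k)); rewrite subrK -angD; congr ang; lia.
rewrite [cos (ang p (2 * (k * x.+1)))](_ : _ = cos (ang p ((2 * x).+1 * k) + ang p k)); last first.
  by rewrite -angD; congr (cos (ang _ _)); lia.
by rewrite /cosec cosB cosD; field; rewrite pR s0.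
Qed.

(** This is cot t <= 1/t without division: sin x - x cos x vanishes at 0 and has derivative x sin x
    >= 0. *)
Lemma mul_cos_le_sin (R : realType) (t : R) : 0 < t <= pi -> t * cos t <= sin t.
Proof.
move=> /andP[t0 tpi].
pose f (x : R) := sin x - x * cos x.
have df (x : R) : is_derive x 1 f (x * sin x).
  by apply: trigger_derive; rewrite /GRing.scale /=; ring.
have [|c] := @MVT R f (fun x => x * sin x) 0 t t0 (fun x _ => df x).
  apply: continuous_subspaceT => x; apply: differentiable_continuous.
  exact/derivable1_diffP.
rewrite in_itv /= => /andP[c0 ct] fE.
have : 0 <= f t - f 0.
  rewrite fE !mulr_ge0 ?(ltW c0) ?subr_ge0 ?(ltW t0)// sin_ge0_pi//.
  by rewrite ltW//= (le_trans (ltW ct)).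
by rewrite /f sin0 mul0r subrr subr0 subr_ge0.
Qed.

(** A new term 1/a, with a = 2h + 1, is paid for by ln((a+2)/a) >= 2/(a+2), which is at least 1/a
    once a >= 2. The first term, a = 1, is covered by the leading 1. *)
Lemma sum_inv_odd_le (R : realType) h :
  \sum_(x < h) (2 * x).+1%:R^-1 <= 1 + ln (2 * h).+1%:R :> R.
Proof.
elim: h => [|h IH]; first by rewrite big_ord0 ln1 addr0.
rewrite big_ord_recr /=.
have [h0|h0] := posnP h.
  by rewrite h0 big_ord0 add0r invr1 lerDl ln_ge0// ler1n.
apply: le_trans (lerD IH (lexx _)) _; rewrite -addrA lerD2l.
set a : R := (2 * h).+1%:R; rewrite (_ : (2 * h.+1).+1 = (2 * h).+1 + 2)%N; last lia.
rewrite natrD -/a; have a3 : 3 <= a by rewrite ler_nat; lia.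
have : ln (1 + (a / (a + 2) - 1)) <= a / (a + 2) - 1.
  by apply: le_ln1Dx; rewrite ltrBrDl subrr divr_gt0//; lra.
rewrite (addrC 1) subrK ln_div ?posrE; [|lra|lra].
have : a / (a + 2) - 1 = - (2 / (a + 2)) by field; lra.
have : a^-1 <= 2 / (a + 2).
  by rewrite ler_pdivlMr; [rewrite ler_pdivrMl; lra|lra].
by move=> H1 -> H2; rewrite -lerBrDl (le_trans H1)// -lerN2 opprB.
Qed.

Lemma cos_transform_cosec_le_succ (R : realType) p x : ((2 * x).+1 < p)%N ->
  cos_transform p (cosec p) x.+1 <= cos_transform p (cosec p) x :> R /\
  cos_transform p (cosec p) x - cos_transform p (cosec p) x.+1
    <= 2 * (2 * x).+1%:R^-1 :> R.
Proof.
move=> xp; have p0 : 0 < p%:R :> R by rewrite ltr0n; lia.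
have n0 : 0 < (2 * x).+1%:R :> R by rewrite ltr0n.
have pige : 2 <= pi :> R := pi_ge2 R.
rewrite -subr_ge0 cos_transform_cosec_diff//; set t := _ / 2.
have tE : t = pi * (2 * x).+1%:R / (2 * p%:R).
  by rewrite /t /ang; field; rewrite lt0r_neq0.
have t0 : 0 < t by rewrite tE divr_gt0 ?mulr_gt0// ?pi_gt0.
have tpi : t < pi / 2.
  rewrite tE ltr_pdivrMr ?mulr_gt0// mulrA divfK ?pnatr_eq0//.
  by rewrite ltr_pM2l ?pi_gt0// ltr_nat.
have st : 0 < sin t by apply: sin_gt0_pi; apply/andP; split; lra.
split.
  rewrite !mulr_ge0 ?invr_ge0 ?(ltW p0) ?(ltW st)// cos_ge0_pihalf//.
  by apply/andP; split; lra.
have ct : cos t / sin t <= t^-1.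
  rewrite ler_pdivrMr// ler_pdivlMl// mul_cos_le_sin// t0 /=; lra.
apply: le_trans (_ : 2 / p%:R * t^-1 <= _).
  by rewrite ler_wpM2l// divr_ge0// ltW.
(* The bound obtained is 4 / (pi (2x+1)); then pi >= 2 is enough. *)
rewrite (_ : 2 / p%:R * t^-1 = 4 / pi * (2 * x).+1%:R^-1); last first.
  rewrite tE; move: (pi : R) ((2 * x).+1%:R : R) (lt0r_neq0 (pi_gt0 R)) (lt0r_neq0 n0).
  by move=> q n q0 nn0; field; rewrite nn0 q0 lt0r_neq0.
by rewrite ler_pM2r ?invr_gt0// ler_pdivrMr ?pi_gt0//; lra.
Qed.

Lemma cos_transform_cosec_homo (R : realType) p x y : (x <= y)%N ->
  (2 * y <= p)%N -> cos_transform p (cosec p) y <= cos_transform p (cosec p) x :> R.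
Proof.
move=> + yp; elim: y yp => [|y IH] yp; first by rewrite leqn0 => /eqP ->.
rewrite leq_eqVlt => /predU1P[->//|xy]; apply: le_trans (IH _ _); [|lia|lia].
by have [|//] := @cos_transform_cosec_le_succ R p y; lia.
Qed.

(** By monotonicity and symmetry this is the least value of the transform, whose values sum to 0. *)
Lemma cos_transform_cosec_half_le0 (R : realType) h :
  cos_transform (2 * h).+1 (cosec (2 * h).+1) h <= 0 :> R.
Proof.
set p := (2 * h).+1; set L := cos_transform p _.
have Lx x : (x < p)%N -> L h <= L x.
  move=> xp; have [xh|hx] := leqP x h.
    by apply: cos_transform_cosec_homo; lia.
  rewrite -[L x](cos_transform_sym _ (isT : (0 < p)%N) (ltnW xp)).
  by apply: cos_transform_cosec_homo; lia.
have := @sum_cos_transform R p (cosec p) isT.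
rewrite {1}/cosec ang0 sin0 mulr0 invr0 => /(_ erefl) sL.
have : \sum_(x < p) L h <= \sum_(x < p) L x by apply: ler_sum => x _; apply: Lx.
by rewrite sL sumr_const card_ord pmulrn_lle0.
Qed.

Lemma cosec_ge0 (R : realType) p k : (k < p)%N -> 0 <= cosec p k :> R.
Proof. by move=> kp; rewrite invr_ge0 mulr_ge0// sin_ang_ge0. Qed.

Lemma cos_transform0_ge0 (R : realType) p (w : nat -> R) :
  (forall k, (k < p)%N -> 0 <= w k) -> 0 <= cos_transform p w 0.
Proof.
move=> w0; apply: sumr_ge0 => k _.
by rewrite !muln0 ang0 cos0 mulr1 w0.
Qed.

(** This bounds the mass of the weight: going from h, where the transform is at most 0, back to 0,
    the successive increments add up to a sum of inverse odd numbers. *)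
Lemma cos_transform_cosec0_le (R : realType) h :
  cos_transform (2 * h).+1 (cosec (2 * h).+1) 0 <= 2 + 2 * ln (2 * h).+1%:R :> R.
Proof.
set p := (2 * h).+1; set L := cos_transform p _.
have tele y : (y <= h)%N -> L 0%N - L y <= 2 * \sum_(x < y) (2 * x).+1%:R^-1.
  elim: y => [|y IH] yh; first by rewrite big_ord0 mulr0 subrr.
  have [|_ Ly] := @cos_transform_cosec_le_succ R p y; first by rewrite /p; lia.
  rewrite big_ord_recr /= mulrDr -(subrKA (L y)); exact: lerD (IH (ltnW yh)) Ly.
have := tele h (leqnn h); have := cos_transform_cosec_half_le0 R h.
have := sum_inv_odd_le R h; rewrite -/p -/L; set s := \sum_(x < h) _. lra.
Qed.

(** * Placing the jump *)

(* The cutoff [m] is the last index at which [L m + 1 - (2 m + 1) / p] exceeds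
   1/8; the value then drops by 1 from [m] to [m + 1], so it jumps over 0. *)
Lemma exists_cutoff (R : realType) h : (0 < h)%N -> let p := (2 * h).+1 in
  exists2 m, (m < h)%N & forall x, (x <= h)%N ->
    8^-1 <= `|cos_transform p (cosec p) x + cos_transform p (dirichlet p m) x| :> R.
Proof.
move=> h0 p; set L := cos_transform p (cosec p).
pose g m : R := L m + 1 - (2 * m).+1%:R / p%:R.
have p3 : 3 <= p%:R :> R by rewrite ler_nat /p; lia.
have pV : p%:R^-1 <= 3^-1 :> R by rewrite lef_pV2 ?posrE//; lra.
have g0 : 8^-1 <= g 0%N.
  have : 0 <= L 0%N by apply: cos_transform0_ge0 => k; apply: cosec_ge0.
  by rewrite /g muln0 mul1r; lra.
have gh : g h < 8^-1.
  have := cos_transform_cosec_half_le0 R h; rewrite -/p -/L /g mulfV; first lra.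
  by rewrite lt0r_neq0//; lra.
have [m [mh gm gm1]] : exists m, [/\ (m < h)%N, 8^-1 <= g m & g m.+1 < 8^-1].
  have : exists n, (n <= h)%N && (g n < 8^-1) by exists h; rewrite leqnn.
  move=> /ex_minnP[[|m] /andP[mh gm] mmin]; first by move: gm; rewrite ltNge g0.
  exists m; split=> //; rewrite leNgt; apply/negP => gm'.
  by have := mmin m; rewrite gm' (ltnW mh) ltnn => /(_ isT).
exists m => // x xh; rewrite cos_transform_dirichlet; last by rewrite /p; lia.
have [xm|mx] := leqP x m.
  apply: le_trans (ler_norm _); apply: le_trans gm _.
  rewrite /g -addrA lerD2r; apply: cos_transform_cosec_homo => //; rewrite /p; lia.
rewrite -normrN; apply: le_trans (ler_norm _); rewrite sub0r opprD opprK.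
have : L x <= L m.+1 by apply: cos_transform_cosec_homo => //; rewrite /p; lia.
(* As p >= 3, the value past the jump is below 1/8 - 1 + 2/p <= -5/24, hence below -1/8. *)
move: gm1; rewrite /g (_ : (2 * m.+1).+1 = (2 * m).+1 + 2)%N; last lia.
rewrite natrD mulrDl -/L; lra.
Qed.

(** * Normalisation and conclusion *)

Lemma ln_natr_ge (R : realType) p : (1 < p)%N -> 1 - p%:R^-1 <= ln p%:R :> R.
Proof.
move=> p1; have p0 : 0 < p%:R :> R by rewrite ltr0n; lia.
have : ln (1 + (p%:R^-1 - 1)) <= p%:R^-1 - 1 :> R.
  by apply: le_ln1Dx; rewrite ltrBrDl subrr invr_gt0.
by rewrite addrC subrK lnV ?posrE//; lra.
Qed.

Lemma exists_correlation_odd (R : realType) h : (0 < h)%N ->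
  let p := (2 * h).+1 in
  exists f : 'Z_p -> R,
    [/\ expect f = 0, norm2 f <= 1 &
        forall x, 64^-1 / ln p%:R <= `|conv f (refl f) x| ].
Proof.
move=> h0 p; have [m mh bnd] := exists_cutoff R h0.
have lnp : 2 / 3 <= ln p%:R :> R.
  have p1 : (1 < p)%N by rewrite /p; lia.
  apply: le_trans (ln_natr_ge R p1).
  have : p%:R^-1 <= 3^-1 :> R.
    by rewrite lef_pV2 ?posrE ?ltr0n// ler_nat /p; lia.
  lra.
have lnp0 : 0 < ln p%:R :> R by lra.
(* The mass before scaling is at most (2 + 2 ln p) + 1, which is at most 8 ln p since ln p >= 1/2.
   The lower bound 1/8 then becomes 1/(64 ln p). *)
pose a : R := (8 * ln p%:R)^-1.
have a0 : 0 < a by rewrite invr_gt0 mulr_gt0.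
pose w k : R := a * (cosec p k + dirichlet p m k).
have wE k : w k = a * ((1 + sin (ang p ((2 * m).+1 * k))) * cosec p k).
  by rewrite /w /dirichlet mulrDl mul1r.
have TE x : cos_transform p w x =
    a * (cos_transform p (cosec p) x + cos_transform p (dirichlet p m) x).
  by rewrite cos_transformZ cos_transformD.
have [||||f [Ef Nf Cf]] := @exists_autocorrelation R p w.
- by rewrite /p; lia.
- move=> k kp; rewrite wE !mulr_ge0 ?(ltW a0) ?cosec_ge0//.
  by have := sin_geN1 (ang p ((2 * m).+1 * k) : R); lra.
- by rewrite wE /cosec ang0 sin0 mulr0 invr0 !mulr0.
(* For the symmetry of [w]: replacing k by p - k reflects both angles about odd multiples of pi/2,
   the numerator's because 2m + 1 is odd. *)
- have sinB n (b c : R) : b + c = pi *+ (2 * n).+1 -> sin b = sin c.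
    move=> bc; rewrite (_ : b = - c + pi + pi *+ 2 *+ n).
      by rewrite (periodicn (@sinD2pi R)) sinDpi sinN opprK.
    by apply: (addIr c); rewrite bc (mulrS pi (2 * n)) (mulrnA pi 2 n); ring.
  move=> k /andP[k0 kp]; rewrite !wE /cosec; congr (_ * ((1 + _) * (_ * _)^-1)).
    apply: (sinB m); rewrite -angD -(@ang_period R p)//; congr ang; nia.
  apply: (sinB 0%N); rewrite -angD -(@ang_period R p)//; congr ang; lia.
have pp : (0 < p)%N by [].
exists f; split=> //.
  rewrite Nf -[leRHS]sqrtr1 ler_wsqrtr// TE /a ler_pdivrMl ?mulr_gt0// mulr1.
  rewrite cos_transform_dirichlet /=; last by rewrite addn0 /p; lia.
  have : 0 <= (2 * m).+1%:R / p%:R :> R by rewrite divr_ge0.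
  have := cos_transform_cosec0_le R h; rewrite -/p; lra.
move=> x; rewrite Cf TE normrM gtr0_norm//.
rewrite (_ : 64^-1 / ln p%:R = a * 8^-1); last first.
  by rewrite /a; field; rewrite lt0r_neq0.
rewrite ler_pM2l//; move: (nat_of_ord x) (ltn_ord x) => {}x.
rewrite [X in (_ < X)%N -> _]Zp_cast => [xp|]; last by rewrite /p; lia.
have [xh|hx] := leqP x h; first exact: bnd.
rewrite -!(cos_transform_sym _ pp (ltnW xp)).
by apply: bnd; rewrite /p; lia.
Qed.

Theorem theorem1p6 (R : realType) :
  exists2 c : R, 0 < c &
    forall p : nat, prime p ->
      exists f : 'Z_p -> R,
        [/\ expect f = 0,
            norm2 f <= 1 &
            forall x : 'Z_p, c / ln p%:R <= `|conv f (refl f) x| ].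
Proof.
exists 64^-1 => [|p pr_p]; first by rewrite invr_gt0 ltr0n.
have p1 := prime_gt1 pr_p.
have [p2|podd] := even_prime pr_p; last first.
  have -> : p = (2 * p./2).+1 by rewrite -[LHS]odd_double_half podd -mul2n.
  by apply: exists_correlation_odd; have := odd_double_half p; rewrite podd; lia.
(* For p = 2, unit mass at the frequency 1 gives an autocorrelation with values 1 and -1, so ln 2 >=
   1/2 suffices. *)
rewrite {}p2 {pr_p p1 p}.
have [||||f [Ef Nf Cf]] := @exists_autocorrelation R 2 (fun k => (k == 1%N)%:R).
- by [].
- by [].
- by [].
- by case=> [|[|k]].
have TE x : cos_transform 2 (fun k => (k == 1%N)%:R) x = cos (pi *+ x) :> R.
  rewrite /cos_transform big_ord_recl big_ord1 /= mul0r add0r mul1r.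
  by congr cos; rewrite mul1n mulnC ang_period.
exists f; split=> //; first by rewrite Nf TE mulr0n cos0 sqrtr1.
move=> x; rewrite Cf TE (_ : `|_| = 1); last first.
  by rewrite -[pi *+ x]add0r (alternatingn (@cosDpi R)) cos0 mulr1 normrX normrN1 expr1n.
have := @ln_natr_ge R 2 isT; move=> l2.
rewrite ler_pdivrMr; lra.
Qed.
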